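(* Let $\{X_t\}_{t\ge0}$ be the unlabelled exclusion process on the complete graph on $n$ vertices with $n$ balls in total and $\ell=\ell(n)$ black balls, and set the intensity to $\alpha=2/n^2$. Let $\pi$ be the uniform distribution on its state space. Then for any $\ell\le n/2$, $$\|\mathbb{P}(X_t\in\cdot)-\pi\|_2^2=\sum_{i=1}^{\ell}\left(\binom ni-\binom n{i-1}\right)e^{-4i(n-i+1)t/n^2}.$$ As a consequence, writing $t=\frac14 n\log(n-1)+cn$ for a constant $c$, $$e^{-2c}\le\|\mathbb{P}(X_t\in\cdot)-\pi\|_2\le 2e^{-2c},$$ where the upper bound holds for $c\ge0$ and sufficiently large $n$. In particular, for all $\ell$ and all $\epsilon\in(0,1)$, $$\tau_2(\epsilon)=\tfrac14 n\log n+C(\epsilon)\,n$$ for a constant $C(\epsilon)$ depending on $\epsilon$.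
   Context: Let $V$ be the vertex set of the complete graph on $n$ vertices and let $\binom V\ell$ denote the set of $\ell$-element subsets of $V$. The unlabelled exclusion process (UEP) with parameter $\ell$ (a positive integer with $\ell\le n/2$; the number of black balls, the remaining $n-\ell$ balls being white) and intensity $\alpha>0$ is the continuous time Markov process $\{X_t\}_{t\ge0}$ on $\binom V\ell$ (the state is the set of vertices holding a black ball), started from an arbitrary but fixed state, with generator $[q_{J,J'}]_{J,J'\in\binom V\ell}$ given by $q_{J,J}=-\alpha\ell(n-\ell)$, $q_{J,J'}=\alpha$ if $|J\,\Delta\,J'|=2$, and $q_{J,J'}=0$ otherwise. Its stationary distribution $\pi$ is uniform on $\binom V\ell$. For probability measures $\mu$ and $\pi$ on a finite set $S$, $\|\mu-\pi\|_2^2=\sum_{s\in S}\frac{(\mu(s)-\pi(s))^2}{\pi(s)}$, which equals $|S|\sum_{s\in S}(\mu(s)-\pi(s))^2$ when $\pi$ is uniform. $\mathbb{P}_{x_0}$ denotes the underlying probability measure when the process starts from $X_0=x_0$; by symmetry $\|\mathbb{P}_{x_0}(X_t\in\cdot)-\pi\|_2$ does not depend on $x_0$, so $x_0$ is dropped from the notation. The $L^2$-mixing time is $\tau_2(\epsilon)=\inf\{t:\max_{x_0}\|\mathbb{P}_{x_0}(X_t\in\cdot)-\pi\|_2\le2\epsilon\}$.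
   Formalization: C(ε) is not one fixed number: it may vary with n and ℓ, but is bounded in absolute value by a constant depending only on ε; literal equality fails, as for ℓ=1 it would need C=¼(log(1−1/n)−log 4ε²). *)

(* Defs.v *)
From mathcomp Require Import all_boot all_order all_algebra.
From mathcomp Require Import all_classical all_reals all_analysis.
Set Implicit Arguments.
Unset Strict Implicit.
Unset Printing Implicit Defensive.
Import Order.TTheory GRing.Theory Num.Theory.
Import numFieldTopology.Exports numFieldNormedType.Exports.
Local Open Scope classical_set_scope.
Local Open Scope ring_scope.

Section MarkovProcess.
Context {R : realType} {S : finType}.

(* The entries of p are constrained only at nonnegative times. *)
Record transition_semigroup (q : S -> S -> R) (p : R -> S -> S -> R) : Prop :=
  TransitionSemigroup {
    semigroup_ge0 : forall (t : R) x y, 0 <= t -> 0 <= p t x y ;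
    semigroup_sum1 : forall (t : R) x, 0 <= t -> \sum_(y : S) p t x y = 1 ;
    semigroup_0 : forall x y, p 0 x y = (x == y)%:R ;
    semigroup_add : forall (s t : R) x y, 0 <= s -> 0 <= t ->
      p (s + t) x y = \sum_(z : S) p s x z * p t z y ;
    semigroup_generator : forall x y,
      (fun h : R => (p h x y - (x == y)%:R) / h) @ 0^'+ --> q x y }.

(* P x is the law on Omega under which the process starts from x.  The Markov
   property is written without conditional probabilities: the past is a
   cylinder event, given by a list past of pairs (time, state). *)
Record markov_process (q : S -> S -> R) (d : measure_display)
    (Omega : measurableType d) (P : S -> probability Omega R)
    (X : R -> Omega -> S) : Prop := MarkovProcess {
  process_measurable : forall (t : R) y, 0 <= t -> measurable (X t @^-1` [set y]) ;
  process_initial : forall x, P x (X 0 @^-1` [set x]) = 1%E ;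
  process_markov : exists p, transition_semigroup q p /\
    forall (x0 : S) (past : seq (R * S)) (t h : R) (x y : S),
      0 <= t -> 0 <= h -> all (fun r => 0 <= r.1 <= t) past ->
      let A := [set w | all (fun r => X r.1 w == r.2) past] in
      P x0 (A `&` X t @^-1` [set x] `&` X (t + h) @^-1` [set y]) =
      (P x0 (A `&` X t @^-1` [set x]) * (p h x y)%:E)%E }.

Definition process_law (d : measure_display) (Omega : measurableType d)
    (P : S -> probability Omega R) (X : R -> Omega -> S) (x0 : S) (t : R)
    (y : S) : R :=
  fine (P x0 (X t @^-1` [set y])).

Definition uniform_dist (y : S) : R := #|S|%:R^-1.

Definition l2_dist (mu pi : S -> R) : R :=
  Num.sqrt (\sum_(s : S) (mu s - pi s) ^+ 2 / pi s).

(* Extended-real infimum, equal to +oo if the level 2 * eps is never reached. *)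
Definition l2_mixing_time (d : measure_display) (Omega : measurableType d)
    (P : S -> probability Omega R) (X : R -> Omega -> S) (pi : S -> R)
    (eps : R) : \bar R :=
  ereal_inf [set t%:E | t in [set t : R | 0 <= t /\
    \big[Num.max/0]_(x0 : S) l2_dist (process_law P X x0 t) pi <= 2 * eps]].

End MarkovProcess.

Definition uep_state (n l : nat) := {J : {set 'I_n} | #|J| == l}.

Definition symdiff (T : finType) (A B : {set T}) : {set T} :=
  (A :\: B) :|: (B :\: A).

Definition uep_generator (R : realType) (n l : nat) (alpha : R)
    (J J' : uep_state n l) : R :=
  if J == J' then - (alpha * l%:R * (n%:R - l%:R))
  else if #|symdiff (val J) (val J')| == 2%N then alpha
  else 0.

Definition is_uep (R : realType) (n l : nat) (alpha : R) (d : measure_display)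
    (Omega : measurableType d) (P : uep_state n l -> probability Omega R)
    (X : R -> Omega -> uep_state n l) : Prop :=
  markov_process (uep_generator alpha) P X.

(* Main.v *)
Require Import Defs.
From mathcomp Require Import all_boot all_order all_algebra.
From mathcomp Require Import all_classical all_reals all_analysis.
From mathcomp Require Import zify ring lra.
Set Implicit Arguments.
Unset Strict Implicit.
Unset Printing Implicit Defensive.
Import Order.TTheory GRing.Theory Num.Theory.
Import numFieldTopology.Exports numFieldNormedType.Exports.
Local Open Scope classical_set_scope.
Local Open Scope ring_scope.

(** The law of the process at time t is a row of a transition matrix p t, which
    is symmetric because the generator is.  Hence
    #|S| * sum_y (p t x y - 1/#|S|)^2 = #|S| * p (2t) x x - 1, and since
    permutations of the n vertices act transitively on l-subsets and preserve the
    generator, all return probabilities agree, so this is tr (p (2t)) - 1.  The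
    squared distance is therefore a trace, and no eigenvector is ever needed.

    To compute the trace, let U be the inclusion matrix of (l-1)-subsets in
    l-subsets, and write L_l for the generator of intensity 1 on l-subsets.  Then
    U U^T = L_l + c and U^T U = L_(l-1) + c with the same constant
    c = l (n - l + 1) ([up_down_generator], [down_up_generator]).  The products
    U U^T and U^T U share their nonzero spectrum, so passing from L_(l-1) to L_l
    only adds the eigenvalue -l (n - l + 1), with multiplicity
    C(n,l) - C(n,l-1).  In terms of traces of powers this is
    [mxtrace_shift_mulC], and [johnson_trace] is its iteration.

    Traces of powers suffice, because any transition semigroup with generator Q
    satisfies p t = lim (1 + t Q / m)^m ([semigroup_cvg_power]): p (t/m) and
    1 + t Q / m are both stochastic and differ by o(1/m), so their m-th powers
    differ by o(1).  The same limit transfers symmetry and invariance from the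
    generator to p.

    For the asymptotics, the term i = 1 of the sum equals
    (n-1) exp (-4t/n), which is exp (-4c) at t = n ln(n-1) / 4 + c n; the other
    terms are nonnegative.  For the upper bound with c >= 0, every term carries a
    factor at most exp (-4c).  What remains of the term of index i is, as
    C(n,i) - C(n,i-1) <= (n-1)^i / i!, at most (n-1)^(i(i-1)/n) / i!, and for
    i <= n/2 convexity of the exponential gives
    (n-1)^((i-1)/n) <= 1 + 2 (i-1) / sqrt n.  For n >= 1600 this yields the
    majorant (1 + (i-1)/20)^i / i!, whose successive ratios are at most 3/4; as it
    equals 1 at i = 1, the sum is at most 4.  The finitely many smaller n only
    change the constant, which the estimate of the mixing time absorbs. *)

(** * Powers of stochastic matrices *)

Definition stochastic (R : numDomainType) N (A : 'M[R]_N) : Prop :=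
  (forall i j, 0 <= A i j) /\ (forall i, \sum_j A i j = 1).

Lemma stochasticX (R : numDomainType) N (A : 'M[R]_N) (m : nat) :
  stochastic A -> stochastic (A ^+ m).
Proof.
move=> [A0 A1]; elim: m => [|m [IH0 IH1]].
  rewrite expr0; split=> [i j|i]; first by rewrite mxE ler0n.
  rewrite (bigD1 i) //= mxE eqxx big1 ?addr0 // => j ji.
  by rewrite mxE eq_sym (negPf ji).
rewrite exprS; split=> [i j|i].
  by rewrite mxE sumr_ge0 // => k _; rewrite mulr_ge0.
under eq_bigr do rewrite mxE.
rewrite exchange_big /= -[RHS](A1 i); apply: eq_bigr => k _.
by rewrite -mulr_sumr IH1 mulr1.
Qed.

(** Telescoping: A^(m+1) - B^(m+1) = A (A^m - B^m) + (A - B) B^m, and stochastic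
    factors do not increase the norm. *)
Lemma stochastic_subX_le (R : numDomainType) N (A B : 'M[R]_N) (e : R) :
  stochastic A -> stochastic B ->
  (forall i, \sum_j `|A i j - B i j| <= e) ->
  forall m i, \sum_j `|(A ^+ m) i j - (B ^+ m) i j| <= m%:R * e.
Proof.
move=> sA sB ABe; elim=> [|m IH] i.
  by rewrite mul0r big1 // => j _; rewrite subrr normr0.
have [A0 A1] := sA; have [Bm0 Bm1] := stochasticX m sB.
have step j : `|(A ^+ m.+1) i j - (B ^+ m.+1) i j| <=
    \sum_k A i k * `|(A ^+ m) k j - (B ^+ m) k j| +
    \sum_k `|A i k - B i k| * (B ^+ m) k j.
  rewrite !exprS !mxE -sumrB -big_split /=.
  apply: le_trans (ler_norm_sum _ _ _) _; apply: ler_sum => k _.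
  have -> : A i k * (A ^+ m) k j - B i k * (B ^+ m) k j =
    A i k * ((A ^+ m) k j - (B ^+ m) k j) + (A i k - B i k) * (B ^+ m) k j.
    by ring.
  apply: le_trans (ler_normD _ _) _.
  by rewrite !normrM (ger0_norm (A0 _ _)) (ger0_norm (Bm0 _ _)).
apply: le_trans (ler_sum _ (fun j _ => step j)) _.
rewrite big_split /= -natr1 mulrDl mul1r; apply: lerD.
  rewrite exchange_big /=.
  under eq_bigr do rewrite -mulr_sumr.
  have -> : m%:R * e = \sum_k A i k * (m%:R * e) by rewrite -mulr_suml A1 mul1r.
  apply: ler_sum => k _.
  apply: ler_wpM2l; [exact: A0 | exact: IH].
rewrite exchange_big /=.
under eq_bigr do rewrite -mulr_sumr Bm1 mulr1.
exact: ABe.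
Qed.

(** * Transition semigroups as limits of powers *)

Lemma sum_enum_val (R : nmodType) (S : finType) (F : S -> R) :
  \sum_(i < #|S|) F (enum_val i) = \sum_(x : S) F x.
Proof. by rewrite (reindex _ (onW_bij _ (enum_val_bij S))). Qed.

Lemma cvg_fin_sum (R : realType) (T : Type) (F : set_system T)
    {FF : Filter F} (I : finType) (u : I -> T -> R) (l : I -> R) :
  (forall i, u i x @[x --> F] --> l i) ->
  \sum_i u i x @[x --> F] --> \sum_i l i.
Proof. by move=> ul; apply: cvg_big => //; exact: add_continuous. Qed.

Lemma cvg_fin_sum0 (R : realType) (T : Type) (F : set_system T) {FF : Filter F}
    (I : finType) (u : I -> T -> R) :
  (forall i, u i x @[x --> F] --> (0 : R)) ->
  \sum_i u i x @[x --> F] --> (0 : R).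
Proof. by move=> /cvg_fin_sum; rewrite big1. Qed.

Definition kernel_mx (R : Type) (S : finType) (f : S -> S -> R) : 'M[R]_#|S| :=
  \matrix_(i, j) f (enum_val i) (enum_val j).

Section Semigroup.
Variables (R : realType) (S : finType) (q : S -> S -> R) (p : R -> S -> S -> R).
Hypothesis pq : transition_semigroup q p.

Lemma kernel_mx_semigroup (m : nat) (s : R) : 0 <= s ->
  kernel_mx (p (m%:R * s)) = kernel_mx (p s) ^+ m.
Proof.
move=> s0; elim: m => [|m IH].
  apply/matrixP => i j; rewrite mul0r expr0 !mxE (semigroup_0 pq).
  by rewrite (inj_eq enum_val_inj).
rewrite exprS -IH; apply/matrixP => i j; rewrite !mxE.
rewrite -natr1 mulrDl mul1r addrC (semigroup_add pq) ?mulr_ge0 ?ler0n //.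
rewrite -sum_enum_val; apply: eq_bigr => k _; by rewrite !mxE.
Qed.

Lemma kernel_mx_stochastic (s : R) : 0 <= s -> stochastic (kernel_mx (p s)).
Proof.
move=> s0; split=> [i j|i]; first by rewrite mxE (semigroup_ge0 pq).
under eq_bigr do rewrite mxE.
by rewrite (sum_enum_val (p s (enum_val i))) (semigroup_sum1 pq).
Qed.

Lemma generator_ge0 x y : x != y -> 0 <= q x y.
Proof.
move=> xy; apply: (cvgr_to_ge (@semigroup_generator _ _ _ _ pq x y)).
near=> h.
have h0 : 0 < h by near: h; exact: nbhs_right_gt.
by rewrite (negPf xy) subr0 divr_ge0 ?(semigroup_ge0 pq) ?ltW.
Unshelve. all: by end_near. Qed.

Lemma generator_sum0 x : \sum_y q x y = 0.
Proof.
have l1 := cvg_fin_sum (@semigroup_generator _ _ _ _ pq x).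
suff l0 : \sum_y (p h x y - (x == y)%:R) / h @[h --> 0^'+] --> (0 : R).
  exact: (cvg_unique (@Rhausdorff R) (l1 _) l0).
apply: cvg_near_cst; near=> h.
have h0 : 0 < h by near: h; exact: nbhs_right_gt.
rewrite -mulr_suml sumrB (semigroup_sum1 pq) ?(ltW h0) //.
rewrite (bigD1 x) //= eqxx big1 ?addr0 ?subrr ?mul0r // => y yx.
by rewrite eq_sym (negPf yx).
Unshelve. all: by end_near. Qed.

(** The bound on s keeps the diagonal nonnegative; the other requirements come
    from p being stochastic, in the limit. *)
Lemma stochastic_1D_generator (s : R) :
  0 <= s -> (forall x, s * - q x x <= 1) ->
  stochastic (1%:M + s *: kernel_mx q).
Proof.
move=> s0 sq; split=> [i j|i].
  rewrite !mxE; case: eqVneq => [->|ij].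
    by have := sq (enum_val j); rewrite mulrN mulr1n; lra.
  by rewrite add0r mulr_ge0 // generator_ge0 // (inj_eq enum_val_inj).
under eq_bigr do rewrite !mxE.
rewrite big_split /= -mulr_sumr (sum_enum_val (q (enum_val i))).
rewrite generator_sum0 mulr0 addr0 (bigD1 i) //= eqxx big1 ?addr0 // => j ji.
by rewrite eq_sym (negPf ji).
Qed.

(** Over the step h = t/(m+1) the matrices p h and 1 + h q are both stochastic for
    large m and differ by h * o(1), the derivative at 0 being q; by
    [stochastic_subX_le] their (m+1)-st powers differ by t * o(1). *)
Lemma semigroup_cvg_power (t : R) i j : 0 <= t ->
  ((1%:M + (t / m.+1%:R) *: kernel_mx q) ^+ m.+1) i j @[m --> \oo] -->
  p t (enum_val i) (enum_val j).
Proof.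
rewrite le_eqVlt => /predU1P[<-|t0].
  rewrite (semigroup_0 pq) (inj_eq enum_val_inj).
  apply: cvg_near_cst; near=> m.
  by rewrite mul0r scale0r addr0 expr1n mxE.
pose h (m : nat) : R := t / m.+1%:R.
have h_gt0 m : 0 < h m by rewrite divr_gt0 // ltr0n.
have h0 : h m @[m --> \oo] --> (0 : R).
  rewrite -(mulr0 t).
  by apply: cvgM; [exact: cvg_cst | exact: cvg_harmonic].
pose err m : R := t * \sum_(i < #|S|) \sum_(j < #|S|)
   `|(p (h m) (enum_val i) (enum_val j) -
      (enum_val i == enum_val j)%:R) / h m - q (enum_val i) (enum_val j)|.
have err0 : err m @[m --> \oo] --> (0 : R).
  rewrite -(mulr0 t); apply: cvgM; first exact: cvg_cst.
  apply: cvg_fin_sum0 => i'.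
  apply: cvg_fin_sum0 => j'.
  apply/norm_cvg0P/subr_cvg0.
  have /cvg_at_rightP := @semigroup_generator _ _ _ _ pq (enum_val i') (enum_val j').
  exact.
apply/subr_cvg0/norm_cvg0P.
apply: (squeeze_cvgr _ (cvg_cst 0) err0); near=> m; rewrite normr_ge0 /=.
have stB : stochastic (1%:M + h m *: kernel_mx q).
  apply: stochastic_1D_generator; first exact: ltW.
  move=> x; apply: (@le_trans _ _ (h m * \sum_y `|q y y|)).
    apply: ler_wpM2l; first exact: ltW.
    rewrite (bigD1 x) //=; apply: le_trans (ler_norm _) _.
    by rewrite normrN lerDl sumr_ge0.
  near: m; set M := \sum_y _; apply: (cvgr_le (0 : R)); last exact: ltr01.
  rewrite -(mul0r M).
  by apply: cvgM; [exact: h0 | exact: cvg_cst].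
have stA := kernel_mx_stochastic (ltW (h_gt0 m)).
have tE : t = m.+1%:R * h m by rewrite /h mulrCA divff ?mulr1 // pnatr_eq0.
pose e := err m / m.+1%:R.
have AB i' : \sum_j' `|kernel_mx (p (h m)) i' j' -
    (1%:M + h m *: kernel_mx q) i' j'| <= e.
  have -> : e = h m * (err m / t)
    by rewrite /e /h; field; rewrite nat1r pnatr_eq0 gt_eqF.
  rewrite /err [t * _]mulrC mulfK ?gt_eqF //.
  rewrite [X in _ <= _ * X](bigD1 i') //= mulrDr.
  rewrite -[leLHS]addr0; apply: lerD; last first.
    apply: mulr_ge0; first exact: ltW.
    by apply: sumr_ge0 => k _; apply: sumr_ge0.
  rewrite mulr_sumr; apply: ler_sum => j' _; rewrite !mxE.
  rewrite -[X in X * `|_|](ger0_norm (ltW (h_gt0 m))) -normrM (inj_eq enum_val_inj).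
  rewrite le_eqVlt; apply/orP; left; apply/eqP; congr `|_|.
  by field; rewrite gt_eqF.
have := stochastic_subX_le stA stB AB m.+1 i.
rewrite -kernel_mx_semigroup ?(ltW (h_gt0 m)) // -tE.
rewrite (_ : m.+1%:R * e = err m); last first.
  by rewrite /e mulrCA divff ?mulr1 // pnatr_eq0.
apply: le_trans; rewrite (bigD1 j) //= distrC mxE lerDl.
by rewrite sumr_ge0.
Unshelve. all: by end_near. Qed.

End Semigroup.

(** * Symmetry, invariance and the return probability *)

Section Reversible.
Variables (R : realType) (S : finType) (q : S -> S -> R) (p : R -> S -> S -> R).
Hypothesis pq : transition_semigroup q p.

Lemma expr_entry_equivariant N (A : 'M[R]_N) (f : 'I_N -> 'I_N) :
  bijective f -> (forall i j, A (f i) (f j) = A i j) ->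
  forall m i j, (A ^+ m) (f i) (f j) = (A ^+ m) i j.
Proof.
move=> bf fA; elim=> [|m IH] i j.
  by rewrite !expr0 !mxE (inj_eq (bij_inj bf)).
rewrite !exprS !mxE (reindex _ (onW_bij _ bf)).
by apply: eq_bigr => k _; rewrite fA IH.
Qed.

(** Invariance under f passes to the powers of 1 + t q / m, hence to their
    limit. *)
Lemma semigroup_equivariant (f : S -> S) (t : R) x y :
  injective f -> (forall x y, q (f x) (f y) = q x y) -> 0 <= t ->
  p t (f x) (f y) = p t x y.
Proof.
move=> finj fq t0; have [g fK gK] := injF_bij finj.
pose r (i : 'I_#|S|) := enum_rank (f (enum_val i)).
have br : bijective r.
  exists (fun i => enum_rank (g (enum_val i))) => i; rewrite /r enum_rankK.
    by rewrite fK enum_valK.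
  by rewrite gK enum_valK.
have := semigroup_cvg_power pq (i := r (enum_rank x)) (j := r (enum_rank y)) t0.
have := semigroup_cvg_power pq (i := enum_rank x) (j := enum_rank y) t0.
rewrite /r !enum_rankK => c1 c2.
apply: (cvg_unique (@Rhausdorff R) c2); move: c1.
under eq_fun => m.
  rewrite -(expr_entry_equivariant br); last first.
    move=> i j; rewrite !mxE !enum_rankK fq (inj_eq enum_rank_inj).
    by rewrite (inj_eq finj) (inj_eq enum_val_inj).
  rewrite /r !enum_rankK; over.
exact.
Qed.

Lemma semigroup_symmetric (t : R) x y :
  (forall x y, q x y = q y x) -> 0 <= t -> p t x y = p t y x.
Proof.
move=> qC t0.
have := semigroup_cvg_power pq (i := enum_rank y) (j := enum_rank x) t0.
have := semigroup_cvg_power pq (i := enum_rank x) (j := enum_rank y) t0.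
rewrite !enum_rankK => c1 c2.
apply: (cvg_unique (@Rhausdorff R) c1); move: c2.
have symX N (A : 'M[R]_N) m : A^T = A -> (A ^+ m)^T = A ^+ m.
  move=> AT; elim: m => [|m IH]; first by rewrite !expr0 trmx1.
  by rewrite [in LHS]exprS trmx_mul IH AT exprSr.
under eq_fun => m.
  rewrite -symX; last first.
    by apply/matrixP => i j; rewrite !mxE eq_sym qC.
  rewrite mxE; over.
exact.
Qed.

(** Expanding the square leaves #|S| * sum_y (p t x y)^2 - 1, and symmetry turns
    the sum into a return probability at time 2t. *)
Lemma l2_dist_uniform_sqr (t : R) x :
  (forall x y, q x y = q y x) -> 0 <= t ->
  l2_dist (p t x) uniform_dist ^+ 2 = #|S|%:R * p (2 * t) x x - 1.
Proof.
move=> qC t0.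
have S0 : 0 < #|S|%:R :> R by rewrite ltr0n; apply/card_gt0P; exists x.
rewrite sqr_sqrtr; last first.
  apply: sumr_ge0 => y _; rewrite divr_ge0 ?sqr_ge0 //.
  by rewrite /uniform_dist invr_ge0 ltW.
transitivity (\sum_y (#|S|%:R * (p t x y * p t y x) - 2 * p t x y + #|S|%:R^-1)).
  apply: eq_bigr => y _; rewrite (semigroup_symmetric y x qC t0) /uniform_dist.
  by field; rewrite gt_eqF.
rewrite big_split sumrB /= -!mulr_sumr (semigroup_sum1 pq) // -(semigroup_add pq) //.
have -> : \sum_(y : S) #|S|%:R^-1 = 1 :> R.
  by rewrite sumr_const -[LHS]mulr_natl mulfV ?gt_eqF.
by rewrite mulr1 [2 * t]mulrDl mul1r; ring.
Qed.

End Reversible.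

(** * From the process to its transition semigroup *)

(** This is the Markov property at time 0 with an empty past, where the event
    that the process starts from x0 has probability 1. *)
Lemma process_law_semigroup (R : realType) (S : finType) (q : S -> S -> R)
    (d : measure_display) (Omega : measurableType d)
    (P : S -> probability Omega R) (X : R -> Omega -> S) :
  markov_process q P X ->
  exists2 p, transition_semigroup q p &
    forall x0 t, 0 <= t -> process_law P X x0 t = p t x0.
Proof.
move=> [mX X0 [p [pq markov]]]; exists p => // x0 t t0; apply/funext => y.
have := markov x0 [::] 0 t x0 y (lexx 0) t0 isT.
rewrite /= (_ : [set w | _] = setT); last exact/seteqP.
rewrite !setTI add0r X0 mul1e /process_law.
set E := X 0 @^-1` _; set F := X t @^-1` _ => EF.
have mE : measurable E by exact: mX.
have mF : measurable F by exact: mX.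
have -> : P x0 F = P x0 (E `&` F).
  rewrite (measureDI (P x0) mF mE) setIC [X in (X + _)%E](_ : _ = 0%E) ?add0e //.
  apply/eqP; rewrite eq_le measure_ge0 andbT.
  have : (P x0 (~` E) = 0)%E by rewrite probability_setC // X0 subee.
  move=> <-; apply: le_measure; rewrite ?inE.
  - exact: measurableD.
  - exact: measurableC.
  - by move=> w [].
by rewrite EF.
Qed.

(** * Traces of shifted products *)

(** A trace form of the fact that U D and D U have the same nonzero spectrum.
    By induction on k: in a further factor a + s U D, the part s U D contributes
    equally on both sides, by cyclicity of the trace and
    (a + s U D)^k U = U (a + s D U)^k, so the discrepancy is multiplied by a. *)
Lemma mxtrace_shift_mulC (R : comNzRingType) p q (U : 'M[R]_(p, q))
    (D : 'M[R]_(q, p)) (a s : R) (k : nat) :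
  \tr ((a%:M + s *: (U *m D)) ^+ k : 'M[R]_p) =
  \tr ((a%:M + s *: (D *m U)) ^+ k : 'M[R]_q) + (p%:R - q%:R) * a ^+ k.
Proof.
set A := _ + _ *: (U *m D); set B := _ + _ *: (D *m U).
have AU m : (A ^+ m : 'M[R]_p) *m U = U *m (B ^+ m : 'M[R]_q).
  elim: m => [|m IH]; first by rewrite !expr0 mul1mx mulmx1.
  rewrite !exprSr -mulmxA.
  have -> : A *m U = U *m B.
    rewrite mulmxDl mulmxDr -scalemxAl -scalemxAr mulmxA.
    by rewrite mul_scalar_mx mul_mx_scalar.
  by rewrite mulmxA IH -mulmxA.
elim: k => [|k IH]; first by rewrite !expr0 !mxtrace1; ring.
have trS r (C : 'M[R]_r) (E : 'M[R]_r) :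
    \tr (C *m (a%:M + s *: E)) = a * \tr C + s * \tr (C *m E).
  by rewrite mulmxDr mul_mx_scalar -scalemxAr mxtraceD !mxtraceZ.
have cyc : \tr (A ^+ k *m (U *m D)) = \tr (B ^+ k *m (D *m U)).
  by rewrite mulmxA AU -mulmxA mxtrace_mulC -mulmxA.
rewrite !exprSr !trS IH cyc; ring.
Qed.

(** * The Johnson graph *)

Lemma symdiffC (T : finType) (A B : {set T}) : symdiff A B = symdiff B A.
Proof. by rewrite /symdiff finset.setUC. Qed.

Lemma card_symdiff (T : finType) (A B : {set T}) :
  (#|symdiff A B| + 2 * #|A :&: B|)%N = (#|A| + #|B|)%N.
Proof.
rewrite /symdiff cardsU.
have -> : (A :\: B) :&: (B :\: A) = finset.set0.
  by apply/setP => x; rewrite !inE; case: (x \in A); case: (x \in B).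
rewrite cards0 subn0 -(cardsID B A) -(cardsID A B) (finset.setIC B A); lia.
Qed.

Lemma card_setI_lt (T : finType) (A B : {set T}) :
  #|A| = #|B| -> A != B -> (#|A :&: B| < #|A|)%N.
Proof.
move=> AB; apply: contraNltn => AI; rewrite eqEcard AB leqnn andbT.
by apply/finset.setIidPl/eqP; rewrite eqEcard finset.subsetIl.
Qed.

Section Johnson.
Variables (R : realType) (n : nat).

Lemma sum_uep_indicator k (a : pred {set 'I_n}) :
  \sum_(K : uep_state n k) (a (val K))%:R =
  #|[set B : {set 'I_n} | a B & #|B| == k]|%:R :> R.
Proof.
rewrite -natr_sum; congr _%:R.
have -> : [set B : {set 'I_n} | a B & #|B| == k] =
    (val @: [set K : uep_state n k | a (val K)])%SET.
  apply/setP => B; rewrite inE; apply/andP/imsetP => [[aB kB]|[K]].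
    by exists (Sub B kB); rewrite ?inE SubK.
  by rewrite inE => aK ->; split=> //; exact: (valP K).
rewrite (card_imset _ val_inj) -sum1_card [RHS]big_mkcond /=.
by apply: eq_bigr => K _; rewrite inE; case: (a _).
Qed.

Lemma card_uep_state k : #|{: uep_state n k}| = 'C(n, k).
Proof.
rewrite -[in RHS](card_ord n) -card_draws card_sig.
by apply: eq_card => B; rewrite !inE.
Qed.

Definition inclusion_mx l k : 'M[R]_(#|{: uep_state n l}|, #|{: uep_state n k}|) :=
  \matrix_(i < #|{: uep_state n l}|, j < #|{: uep_state n k}|)
    (val (enum_val j) \subset val (enum_val i))%:R.

(** The entry counts the k-subsets of the intersection. *)
Lemma mul_inclusion_tr l k i j :
  (inclusion_mx l k *m (inclusion_mx l k)^T) i j =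
  'C(#|val (enum_val i) :&: val (enum_val j)|, k)%:R.
Proof.
rewrite mxE -cards_draws -sum_uep_indicator -[RHS]sum_enum_val.
by apply: eq_bigr => K _; rewrite !mxE -natrM mulnb finset.subsetI.
Qed.

(** The entry counts the l-subsets containing the union, i.e. by complementation
    the (n-l)-subsets of its complement. *)
Lemma mul_tr_inclusion l k i j : (l <= n)%N ->
  ((inclusion_mx l k)^T *m inclusion_mx l k) i j =
  'C(n - #|val (enum_val i) :|: val (enum_val j)|, n - l)%:R.
Proof.
move=> ln; rewrite mxE; set A := _ :|: _.
have -> : (n - #|A|)%N = #|~: A|.
  by rewrite -[X in (X - _)%N]card_ord -(cardsC A) addKn.
rewrite -cards_draws.
have -> : #|[set B : {set 'I_n} | B \subset ~: A & #|B| == (n - l)%N]| =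
    #|[set B : {set 'I_n} | A \subset B & #|B| == l]|.
  rewrite -(card_imset _ (can_inj (@finset.setCK _))); apply: eq_card => B.
  have BC : (#|B| + #|~: B|)%N = n by rewrite cardsC card_ord.
  rewrite -[B in LHS]finset.setCK
    (mem_imset _ _ (can_inj (@finset.setCK _))) !inE finset.setCS.
  by congr (_ && _); lia.
rewrite -sum_uep_indicator -[RHS]sum_enum_val.
by apply: eq_bigr => J _; rewrite !mxE -natrM mulnb finset.subUset.
Qed.

(** Up to sign, the combinatorial Laplacian of the Johnson graph J(n, l). *)
Definition johnson_generator l : 'M[R]_#|{: uep_state n l}| :=
  kernel_mx (@uep_generator R n l 1).

Lemma up_down_generator l : (l < n)%N ->
  inclusion_mx l.+1 l *m (inclusion_mx l.+1 l)^T =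
  johnson_generator l.+1 + (l.+1%:R * (n%:R - l%:R))%:M.
Proof.
move=> ln; apply/matrixP => i j; rewrite mul_inclusion_tr !mxE /uep_generator.
case: (eqVneq i j) => [->|ij].
  rewrite eqxx finset.setIid (eqP (valP (enum_val j))) binSn mulr1n.
  by rewrite -natr1; ring.
rewrite (inj_eq enum_val_inj) (negPf ij) mulr0n addr0.
set J := enum_val i; set J' := enum_val j.
have nJ : J != J' by rewrite (inj_eq enum_val_inj).
have := card_symdiff (val J) (val J').
rewrite (eqP (valP J)) (eqP (valP J')).
have ltI : (#|val J :&: val J'| < l.+1)%N.
  have := @card_setI_lt _ (val J) (val J').
  by rewrite (eqP (valP J)) (eqP (valP J')); apply.
move: (#|_ :&: _|) ltI => m ltI.
move: (#|symdiff _ _|) => d dE.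
case: ifP => [/eqP s2|/eqP s2].
  have -> : m = l by lia.
  by rewrite binn.
by rewrite bin_small //; lia.
Qed.

Lemma down_up_generator l : (l < n)%N ->
  (inclusion_mx l.+1 l)^T *m inclusion_mx l.+1 l =
  johnson_generator l + (l.+1%:R * (n%:R - l%:R))%:M.
Proof.
move=> ln; apply/matrixP => i j; rewrite mul_tr_inclusion // !mxE /uep_generator.
case: (eqVneq i j) => [->|ij].
  rewrite eqxx finset.setUid (eqP (valP (enum_val j))) mulr1n.
  have -> : (n - l = (n - l.+1).+1)%N by lia.
  rewrite binSn -natr1 natrB // -natr1; ring.
rewrite (inj_eq enum_val_inj) (negPf ij) mulr0n addr0.
set J := enum_val i; set J' := enum_val j.
have nJ : J != J' by rewrite (inj_eq enum_val_inj).
have := card_symdiff (val J) (val J').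
have := cardsUI (val J) (val J').
have leU : (#|val J :|: val J'| <= n)%N by rewrite -[leqRHS]card_ord max_card.
have ltI : (#|val J :&: val J'| < l)%N.
  have := @card_setI_lt _ (val J) (val J').
  by rewrite (eqP (valP J)) (eqP (valP J')); apply.
rewrite (eqP (valP J)) (eqP (valP J')).
move: (#|_ :&: _|) (#|_ :|: _|) ltI leU => m u ltI leU uE.
move: (#|symdiff _ _|) => d dE.
case: ifP => [/eqP s2|/eqP s2].
  have -> : u = l.+1 by lia.
  by rewrite binn.
by rewrite bin_small //; lia.
Qed.

(** Each step l -> l+1 adds one eigenvalue: both 1 + s L_(l+1) and 1 + s L_l have
    the form a + s M with M one of the two products of the inclusion matrix, for
    the same a, so [mxtrace_shift_mulC] applies.  The eigenvalue 0 of index 0 has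
    multiplicity 1, whereas C(n, 0) - C(n, 0.-1) is 0 by the convention on
    predecessors, hence the case distinction. *)
Lemma johnson_trace l (s : R) (k : nat) : (l <= n)%N ->
  \tr ((1%:M + s *: johnson_generator l) ^+ k) =
  \sum_(0 <= i < l.+1) ('C(n, i)%:R - (if i is i'.+1 then 'C(n, i')%:R else 0)) *
     (1 - s * (i%:R * (n%:R - i%:R + 1))) ^+ k.
Proof.
elim: l => [|l IH] ln.
  have -> : johnson_generator 0 = 0.
    apply/matrixP => i j; rewrite !mxE /uep_generator.
    suff -> : enum_val i = enum_val j by rewrite eqxx; ring.
    apply: val_inj; have := valP (enum_val i); have := valP (enum_val j).
    by rewrite !cards_eq0 => /eqP -> /eqP ->.
  rewrite scaler0 addr0 expr1n mxtrace1 card_uep_state bin0 big_nat1.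
  by rewrite bin0 mul0r mulr0 !subr0 expr1n mulr1.
rewrite big_nat_recr //= -IH; last exact: ltnW.
pose c : R := l.+1%:R * (n%:R - l%:R).
have shift N (M Q : 'M[R]_N) : Q = M + c%:M ->
    1%:M + s *: M = (1 - s * c)%:M + s *: Q.
  by move=> ->; rewrite scalerDr scale_scalar_mx raddfB /= addrACA addNr addr0.
rewrite (shift _ _ _ (up_down_generator ln)) mxtrace_shift_mulC.
rewrite -(shift _ _ _ (down_up_generator ln)).
move: (\tr _) => T; rewrite !card_uep_state.
by congr (_ + _ * (1 - s * _) ^+ k); rewrite /c -natr1; ring.
Qed.

End Johnson.

(** * The exponential function *)

(** With x = a/(m+1), the bounds 1 + x <= e^x and (1 - x) e^x <= 1 squeeze
    (1 + x)^(m+1) between (1 - x^2)^(m+1) e^a and e^a, and Bernoulli's inequality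
    bounds (1 - x^2)^(m+1) below by 1 - a^2/(m+1). *)
Lemma cvg_exp_power (R : realType) (a : R) :
  (1 + a / m.+1%:R) ^+ m.+1 @[m --> \oo] --> expR a.
Proof.
have a2 : (1 - a ^+ 2 * m.+1%:R^-1) * expR a @[m --> \oo] --> expR a.
  have h0 : a ^+ 2 * m.+1%:R^-1 @[m --> \oo] --> (0 : R).
    rewrite -(mulr0 (a ^+ 2)).
    by apply: cvgM; [exact: cvg_cst | exact: cvg_harmonic].
  suff : (1 - a ^+ 2 * m.+1%:R^-1) * expR a @[m --> \oo] --> (1 - 0) * expR a.
    by rewrite subr0 mul1r.
  by apply: cvgM; [apply: cvgB => //; exact: cvg_cst | exact: cvg_cst].
apply: (squeeze_cvgr _ a2); last exact: cvg_cst.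
near=> m.
have m0 : 0 < m.+1%:R :> R by rewrite ltr0n.
have am : `|a| < m.+1%:R.
  near: m; exists (Num.truncn `|a|) => // k /= hk.
  apply: lt_le_trans (truncnS_gt _) _; by rewrite ler_nat ltnS.
set x := a / m.+1%:R.
have x1 : `|x| < 1 by rewrite normrM normfV (ger0_norm (ltW m0)) ltr_pdivrMr ?mul1r.
have [xl xr] : - 1 < x /\ x < 1 by move: x1; rewrite ltr_norml => /andP[].
have Ea : expR a = expR x ^+ m.+1.
  by rewrite -expRM_natl; congr expR; rewrite /x; field; rewrite nat1r pnatr_eq0.
have x1ge : 0 <= 1 + x by lra.
apply/andP; split; last first.
  by rewrite Ea; apply: lerXn2r; rewrite ?nnegrE ?expR_ge0 ?expR_ge1Dx.
have lo : (1 - x ^+ 2) * expR x <= 1 + x.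
  have e1 : (1 - x) * expR x <= 1.
    have := expR_ge1Dx (- x); rewrite expRN => /(ler_wpM2r (expR_ge0 x)).
    by rewrite mulVf ?gt_eqF ?expR_gt0.
  have -> : (1 - x ^+ 2) * expR x = (1 + x) * ((1 - x) * expR x) by ring.
  by rewrite ler_piMr.
have x2 : 0 <= 1 - x ^+ 2 by nra.
have bern k : 1 - k%:R * x ^+ 2 <= (1 - x ^+ 2) ^+ k.
  elim: k => [|k IH]; first by rewrite expr0 mul0r subr0.
  rewrite [leRHS]exprS; apply: le_trans (ler_wpM2l x2 IH).
  rewrite -natr1.
  have := mulr_ge0 (mulr_ge0 (ler0n R k) (sqr_ge0 x)) (sqr_ge0 x).
  lra.
apply: (@le_trans _ _ (((1 - x ^+ 2) * expR x) ^+ m.+1)); last first.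
  by apply: lerXn2r; rewrite ?nnegrE ?mulr_ge0 ?expR_ge0.
rewrite exprMn -Ea ler_wpM2r ?expR_ge0 //; apply: le_trans (bern _).
rewrite lerD2l lerN2 /x le_eqVlt; apply/orP; left; apply/eqP.
by field; rewrite nat1r pnatr_eq0.
Unshelve. all: by end_near. Qed.


(** Convexity of exp between 0 and y, obtained by averaging the two tangent
    inequalities at a * y. *)
Lemma expR_mul_le (R : realType) (a y : R) : 0 <= a <= 1 ->
  expR (a * y) <= 1 + a * (expR y - 1).
Proof.
move=> /andP[a0 a1].
have e1 : expR (a * y) * (1 + (1 - a) * y) <= expR y.
  have -> : expR y = expR (a * y) * expR ((1 - a) * y).
    by rewrite -expRD; congr expR; ring.
  exact: ler_wpM2l (expR_ge0 _) _ _ (expR_ge1Dx _).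
have e0 : expR (a * y) * (1 - a * y) <= 1.
  have := expR_ge1Dx (- (a * y)); rewrite expRN => /(ler_wpM2l (expR_ge0 (a * y))).
  by rewrite mulfV ?gt_eqF ?expR_gt0.
have a1' : 0 <= 1 - a by rewrite subr_ge0.
have -> : 1 + a * (expR y - 1) = a * expR y + (1 - a) * 1 by ring.
apply: le_trans (lerD (ler_wpM2l a0 e1) (ler_wpM2l a1' e0)).
by rewrite le_eqVlt; apply/orP; left; apply/eqP; ring.
Qed.

Lemma expR_le_invB (R : realType) (u : R) : u < 1 -> expR u <= (1 - u)^-1.
Proof.
move=> u1; rewrite -[u in expR u]opprK expRN lef_pV2 ?posrE ?expR_gt0 ?subr_gt0 //.
exact: expR_ge1Dx.
Qed.

Lemma expR1_le4 (R : realType) : expR 1 <= 4 :> R.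
Proof.
have h : expR (2^-1) <= 2 :> R.
  apply: le_trans (expR_le_invB _) _; first by lra.
  by rewrite (_ : 1 - 2^-1 = 2^-1 :> R) ?invrK //; field.
rewrite (_ : 1 = 2^-1 + 2^-1 :> R); last by field.
have := expR_ge0 (2^-1 : R); rewrite expRD; nra.
Qed.

(** * The L2 distance of the exclusion process *)

(** List A and then its complement, do the same for B, and match the two lists. *)
Lemma injection_of_card_eq (T : finType) (A B : {set T}) :
  #|A| = #|B| -> exists2 f : T -> T, injective f & (f @: A)%SET = B.
Proof.
move=> AB; have [A0|[x0 _]] := finset.set_0Vmem A.
  exists id => //; rewrite imset_id; apply/eqP.
  by rewrite A0 eq_sym -cards_eq0 -AB A0 cards0.
pose enumC (C : {set T}) := enum C ++ enum (~: C)%SET.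
have uC C : uniq (enumC C).
  rewrite cat_uniq !enum_uniq andbT /=; apply/hasPn => x.
  by rewrite !mem_enum inE.
have sC C : size (enumC C) = #|T| by rewrite size_cat -!cardE cardsC.
have memC C x : x \in enumC C by rewrite mem_cat !mem_enum inE orbN.
pose f x := nth x0 (enumC B) (index x (enumC A)).
have finj : injective f.
  move=> x y /eqP; rewrite nth_uniq ?sC -?(sC A) ?index_mem ?memC //.
  by move=> /eqP /(congr1 (nth x0 (enumC A))); rewrite !nth_index.
exists f => //; apply/eqP; rewrite eqEcard card_imset // AB leqnn andbT.
apply/fintype.subsetP => _ /imsetP[x xA ->].
have iA : (index x (enumC A) < #|B|)%N.
  by rewrite index_cat mem_enum xA -AB [ltnRHS]cardE index_mem mem_enum.
by rewrite /f nth_cat -cardE iA -mem_enum mem_nth // -cardE.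
Qed.

Section UEP.
Variables (R : realType) (n l : nat) (alpha : R).
Local Notation q := (@uep_generator R n l alpha).
Variable p : R -> uep_state n l -> uep_state n l -> R.
Hypothesis pq : transition_semigroup q p.

Lemma uep_generatorC x y : q x y = q y x.
Proof. by rewrite /uep_generator eq_sym symdiffC. Qed.

Definition uep_map (f : 'I_n -> 'I_n) (finj : injective f) (J : uep_state n l) :
    uep_state n l :=
  Sub (f @: val J)%SET (eq_ind_r (fun k => k == l) (valP J) (card_imset _ finj)).

Lemma uep_map_inj f (finj : injective f) : injective (uep_map finj).
Proof.
by move=> x y /(congr1 val); rewrite !SubK => /(imset_inj finj) /val_inj.
Qed.

Lemma uep_generator_map f (finj : injective f) x y :
  q (uep_map finj x) (uep_map finj y) = q x y.
Proof.
rewrite /uep_generator (inj_eq (@uep_map_inj _ finj)) !SubK.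
have := card_symdiff (f @: val x)%SET (f @: val y)%SET.
rewrite -imsetI; last exact: in2W.
rewrite !card_imset // -card_symdiff => /addIn.
by move=> ->.
Qed.

(** Vertex relabellings act transitively on the l-subsets. *)
Lemma uep_return_constant (t : R) x y : 0 <= t -> p t x x = p t y y.
Proof.
move=> t0; have [|f finj fxy] := @injection_of_card_eq _ (val x) (val y).
  by rewrite (eqP (valP x)) (eqP (valP y)).
have -> : y = uep_map finj x by apply: val_inj; rewrite SubK fxy.
rewrite (semigroup_equivariant pq _ _ (@uep_map_inj _ finj)) //.
exact: uep_generator_map.
Qed.

Lemma kernel_mx_uep_generator : kernel_mx q = alpha *: johnson_generator R n l.
Proof.
apply/matrixP => i j; rewrite !mxE /uep_generator.
by case: ifP => _; [ring | case: ifP => _; rewrite ?mulr1 ?mulr0].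
Qed.

(** The exact traces of the approximating powers come from [johnson_trace], and
    their limits from [cvg_exp_power]. *)
Lemma uep_trace (t : R) : (l <= n)%N -> 0 <= t ->
  \sum_x p t x x =
  \sum_(0 <= i < l.+1) ('C(n, i)%:R - (if i is i'.+1 then 'C(n, i')%:R else 0)) *
     expR (- (alpha * t * (i%:R * (n%:R - i%:R + 1)))).
Proof.
move=> ln t0; rewrite -(sum_enum_val (fun x => p t x x)) big_mkord.
have cL : \tr ((1%:M + (t / m.+1%:R) *: kernel_mx q) ^+ m.+1) @[m --> \oo] -->
    \sum_(i < #|{: uep_state n l}|) p t (enum_val i) (enum_val i).
  rewrite /mxtrace; apply: cvg_fin_sum => i.
  exact: semigroup_cvg_power.
apply: (cvg_unique (@Rhausdorff R) cL).
have trE m : \tr ((1%:M + (t / m.+1%:R) *: kernel_mx q) ^+ m.+1) =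
    \sum_(i < l.+1) ('C(n, i)%:R - (if val i is i'.+1 then 'C(n, i')%:R else 0)) *
      (1 + - (alpha * t * (i%:R * (n%:R - i%:R + 1))) / m.+1%:R) ^+ m.+1.
  rewrite kernel_mx_uep_generator.
  have -> : (t / m.+1%:R) *: (alpha *: johnson_generator R n l) =
            (t / m.+1%:R * alpha) *: johnson_generator R n l.
    by apply/matrixP => i j; rewrite !mxE mulrA.
  rewrite johnson_trace // big_mkord.
  apply: eq_bigr => i _; congr (_ * _ ^+ _).
  by field; rewrite nat1r pnatr_eq0.
rewrite (funext trE).
apply: cvg_fin_sum => i; apply: cvgM; first exact: cvg_cst.
exact: cvg_exp_power.
Qed.

Lemma uep_l2_dist_sqr x (t : R) : (0 < l)%N -> (l <= n)%N -> 0 <= t ->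
  l2_dist (p t x) uniform_dist ^+ 2 =
  \sum_(1 <= i < l.+1) ('C(n, i)%:R - 'C(n, i.-1)%:R) *
     expR (- (2 * alpha * i%:R * (n%:R - i%:R + 1) * t)).
Proof.
move=> l0 ln t0; rewrite (l2_dist_uniform_sqr pq _ _ t0); last exact: uep_generatorC.
have t20 : 0 <= 2 * t by rewrite mulr_ge0.
have -> : #|{: uep_state n l}|%:R * p (2 * t) x x = \sum_y p (2 * t) y y.
  rewrite (eq_bigr (fun=> p (2 * t) x x)) => [|y _].
    by rewrite sumr_const mulr_natl.
  exact: uep_return_constant.
rewrite uep_trace // big_ltn // bin0 subr0 mul1r mul0r mulr0 oppr0 expR0.
rewrite addrC addKr big_nat_cond [RHS]big_nat_cond.
apply: eq_bigr => -[|i] // _; congr (_ * expR _); ring.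
Qed.

End UEP.

(** * The terms of the spectral sum and their majorant *)

Section Profile.
Variable R : realType.

Definition l2_profile (n l : nat) (t : R) : R :=
  \sum_(1 <= i < l.+1) ('C(n, i)%:R - 'C(n, i.-1)%:R) *
    expR (- (4 * i%:R * (n%:R - i%:R + 1) * t / n%:R ^+ 2)).

Lemma leq_bin_half n i : (2 * i < n)%N -> ('C(n, i) <= 'C(n, i.+1))%N.
Proof.
move=> i2; rewrite -(leq_pmul2l (ltn0Sn i)) mul_bin_left leq_mul2r; lia.
Qed.

Lemma multiplicity_ge0 n i : (0 < i)%N -> (2 * i <= n)%N ->
  0 <= 'C(n, i)%:R - 'C(n, i.-1)%:R :> R.
Proof.
by case: i => // i _ i2; rewrite subr_ge0 ler_nat leq_bin_half //=; lia.
Qed.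

Lemma l2_profile_term_ge0 n i (x : R) : (0 < i)%N -> (2 * i <= n)%N ->
  0 <= ('C(n, i)%:R - 'C(n, i.-1)%:R) * expR x.
Proof. by move=> i0 i2; rewrite mulr_ge0 ?multiplicity_ge0 ?expR_ge0. Qed.

(** The left side is the term of index 1. *)
Lemma l2_profile_ge n l (t : R) : (0 < l)%N -> (2 * l <= n)%N ->
  (n%:R - 1) * expR (- (4 * t / n%:R)) <= l2_profile n l t.
Proof.
move=> l0 l2; rewrite /l2_profile big_ltn // bin0 bin1.
have n0 : n%:R != 0 :> R by rewrite pnatr_eq0; lia.
have -> : 4 * 1%:R * (n%:R - 1%:R + 1) * t / n%:R ^+ 2 = 4 * t / n%:R :> R.
  by field.
rewrite lerDl big_nat_cond; apply: sumr_ge0 => i /andP[il _].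
by apply: l2_profile_term_ge0; lia.
Qed.

(** From C(n,i) <= n C(n,i-1) one gets C(n,i) - C(n,i-1) <= (1 - 1/n) C(n,i), and
    C(n,i) i! <= n (n-1)^(i-1).  The factor 1 - 1/n is what makes the power of
    n - 1 exact, so that it cancels against the exponential at the cutoff time. *)
Lemma multiplicity_le n i : (0 < i)%N -> (2 * i <= n)%N ->
  'C(n, i)%:R - 'C(n, i.-1)%:R <= (n%:R - 1) ^+ i / i`!%:R :> R.
Proof.
case: i => // i _ i2 /=.
have n0 : 0 < n%:R :> R by rewrite ltr0n; lia.
have f0 : 0 < i.+1`!%:R :> R by rewrite ltr0n fact_gt0.
have ffX m k : (m ^_ k <= m ^ k)%N.
  by elim: k => [|k IH]; rewrite ?expn0 ?ffactn0 // ffactnSr expnSr leq_mul ?leq_subr.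
have C1 : ('C(n, i.+1) <= n * 'C(n, i))%N.
  have := mul_bin_left n i.
  have : ((n - i) * 'C(n, i) <= n * 'C(n, i))%N by rewrite leq_mul // leq_subr.
  nia.
have C2 : ('C(n, i.+1) * i.+1`! <= n * n.-1 ^ i)%N.
  by rewrite bin_ffact ffactnS leq_mul2l ffX orbT.
have {}C1 : 'C(n, i.+1)%:R <= n%:R * 'C(n, i)%:R :> R by rewrite -natrM ler_nat.
have {}C2 : 'C(n, i.+1)%:R * i.+1`!%:R <= n%:R * (n%:R - 1) ^+ i :> R.
  have -> : n%:R - 1 = n.-1%:R :> R.
    by rewrite -[in LHS](@prednK n) -?natr1 ?addrK //; lia.
  by rewrite -natrX -!natrM ler_nat.
have n1 : 0 <= n%:R - 1 :> R by rewrite subr_ge0 ler1n; lia.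
rewrite ler_pdivlMr // -(ler_pM2l n0).
apply: (@le_trans _ _ ((n%:R - 1) * ('C(n, i.+1)%:R * i.+1`!%:R))).
  rewrite !mulrA; apply: ler_wpM2r; first exact: ltW.
  by rewrite mulrBr mulrBl mul1r lerD2l lerN2.
by rewrite exprS [leRHS]mulrCA ler_wpM2l.
Qed.

(** For n >= 1600, bounds the multiplicity times the decay at c = 0 of the term of
    index j + 1; the slope 1/20 is 2 / sqrt 1600. *)
Definition majorant (j : nat) : R := (1 + j%:R / 20) ^+ j.+1 / j.+1`!%:R.

(** With i = j + 1, v = 1 + j/20 and w = 1 + i/20, the ratio is
    (w/v)^i * w / (i+1).  Since (w/v)^i <= exp (i / (20 v)) and i / (20 v) is at
    most both i/20 and 1, the first factor is bounded by 1 / (1 - i/20) for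
    i <= 10, and by e <= 4 beyond. *)
Lemma majorantS j : majorant j.+1 <= 3 / 4 * majorant j.
Proof.
set i := j.+1; rewrite /majorant -/i.
set v : R := 1 + j%:R / 20; set w : R := 1 + i%:R / 20.
have i1 : 1 <= i%:R :> R by rewrite ler1n.
have j0 : 0 <= j%:R :> R by rewrite ler0n.
have ij : i%:R = j%:R + 1 :> R by rewrite natr1.
have v1 : 1 <= v by rewrite lerDl divr_ge0.
have v0 : 0 < v by lra.
have vi0 : 0 <= v ^+ i by rewrite exprn_ge0 // ltW.
have wv : w = v * (1 + (20 * v)^-1).
  by rewrite /w ij mulrDr mulr1 invfM mulrCA mulfV ?gt_eqF // /v; field.
have powle (b : R) : i%:R / (20 * v) <= b -> w ^+ i <= expR b * v ^+ i.
  move=> vb; rewrite wv exprMn mulrC; apply: ler_wpM2r; first exact: vi0.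
  apply: (@le_trans _ _ (expR ((20 * v)^-1) ^+ i)).
    apply: lerXn2r; rewrite ?nnegrE ?expR_ge0 ?expR_ge1Dx //.
    by rewrite addr_ge0 // invr_ge0 mulr_ge0 // ltW.
  by rewrite -expRM_natl ler_expR.
have [K [wK KK]] : exists K : R,
    w ^+ i <= K * v ^+ i /\ K * w <= 3 / 4 * (i%:R + 1).
  have [i10|i10] := leqP i 10.
    have i10' : i%:R <= 10 :> R by rewrite ler_nat.
    exists (1 - i%:R / 20)^-1; split.
      apply: (le_trans (powle (i%:R / 20) _)).
        rewrite ler_wpM2l // lef_pV2 ?posrE //; lra.
      by apply: (ler_wpM2r vi0); apply: expR_le_invB; lra.
    rewrite ler_pdivrMl; last lra.
    rewrite /w; nra.
  exists 4; split.
    apply: (le_trans (powle 1 _)).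
      by rewrite ler_pdivrMr /v; lra.
    exact: (ler_wpM2r vi0 (expR1_le4 R)).
  have i10' : 10 <= i%:R :> R by rewrite ler_nat ltnW.
  by rewrite /w; lra.
have w0 : 0 <= w by rewrite /w; lra.
have f0 : 0 < i`!%:R :> R by rewrite ltr0n fact_gt0.
rewrite factS natrM ler_pdivrMr ?mulr_gt0 ?ltr0n ?fact_gt0 //.
have -> : 3 / 4 * (v ^+ i / i`!%:R) * (i.+1%:R * i`!%:R) =
    3 / 4 * (i%:R + 1) * v ^+ i.
  by rewrite -natr1; field; rewrite gt_eqF.
rewrite exprS; apply: le_trans (ler_wpM2l w0 wK) _.
by rewrite mulrA [w * K]mulrC ler_wpM2r.
Qed.

Lemma sum_majorant_le4 l : \sum_(j < l) majorant j <= 4.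
Proof.
have m0 : majorant 0 = 1 by rewrite /majorant mul0r addr0 expr1n divr1.
have mj j : majorant j <= (3 / 4) ^+ j.
  elim: j => [|j IH]; first by rewrite m0 expr0.
  apply: le_trans (majorantS j) _; rewrite exprS ler_wpM2l //; lra.
suff : \sum_(j < l) majorant j <= 4 * (1 - (3 / 4) ^+ l).
  have : 0 <= (3 / 4) ^+ l :> R by rewrite exprn_ge0 //; lra.
  lra.
elim: l => [|l IH]; first by rewrite big_ord0 expr0 subrr mulr0.
rewrite big_ord_recr /=; have := lerD IH (mj l); rewrite exprS; lra.
Qed.

End Profile.

(** * The spectral sum at the cutoff time *)

Section Cutoff.
Variable R : realType.

Definition cutoff_time (n : nat) (c : R) : R :=
  4^-1 * n%:R * ln (n%:R - 1) + c * n%:R.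

(** The decay rates, normalised by the spectral gap, are at least 1. *)
Lemma rate_ge1 n i : (0 < i)%N -> (i <= n)%N ->
  1 <= i%:R * (n%:R - i%:R + 1) / n%:R :> R.
Proof.
move=> i0 i2; have n0 : 0 < n%:R :> R by rewrite ltr0n; lia.
rewrite ler_pdivlMr // mul1r -natrB // natr1 -natrM ler_nat; nia.
Qed.

Lemma l2_profile_exponent n i (c : R) : (0 < n)%N ->
  - (4 * i%:R * (n%:R - i%:R + 1) * cutoff_time n c / n%:R ^+ 2) =
  - (i%:R * (n%:R - i%:R + 1) / n%:R * ln (n%:R - 1)) -
  4 * c * (i%:R * (n%:R - i%:R + 1) / n%:R).
Proof. by move=> n0; rewrite /cutoff_time; field; rewrite pnatr_eq0 -lt0n. Qed.

Lemma l2_profile_term_le n i (c : R) : (0 < i)%N -> (2 * i <= n)%N -> 0 <= c ->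
  ('C(n, i)%:R - 'C(n, i.-1)%:R) *
    expR (- (4 * i%:R * (n%:R - i%:R + 1) * cutoff_time n c / n%:R ^+ 2)) <=
  ('C(n, i)%:R - 'C(n, i.-1)%:R) *
    expR (- (i%:R * (n%:R - i%:R + 1) / n%:R * ln (n%:R - 1))) *
    expR (- (4 * c)).
Proof.
move=> i0 i2 c0; rewrite l2_profile_exponent; last by lia.
rewrite -[leRHS]mulrA; apply: ler_wpM2l; first exact: multiplicity_ge0.
rewrite expRD; apply: ler_wpM2l; first exact: expR_ge0.
rewrite ler_expR lerN2 ler_peMr ?mulr_ge0 //; apply: rate_ge1 => //; lia.
Qed.

(** With L = ln (n-1), the exponential is (n-1)^-(i+1) * exp (i L / n)^(i+1), and
    the negative power cancels the bound on the multiplicity.  Write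
    i L / n = a (L/2) with a = 2i/n in [0,1]; then [expR_mul_le] bounds
    exp (i L / n) by 1 + a sqrt (n-1), and sqrt (n-1) <= n/40 once n >= 1600. *)
Lemma multiplicity_decay_le_majorant n i : (1600 <= n)%N ->
  (2 * i.+1 <= n)%N ->
  ('C(n, i.+1)%:R - 'C(n, i)%:R) *
    expR (- (i.+1%:R * (n%:R - i.+1%:R + 1) / n%:R * ln (n%:R - 1))) <=
  majorant R i.
Proof.
move=> n1600 i2.
have n0 : 0 < n%:R :> R by rewrite ltr0n; lia.
have n1600' : 1600 <= n%:R :> R by rewrite ler_nat.
have n1 : 0 < n%:R - 1 :> R by lra.
set L := ln _.
have EL : expR L = n%:R - 1 by rewrite lnK.
have rootL : expR (2^-1 * L) <= n%:R / 40.
  rewrite -(@ler_pXn2r _ 2) ?nnegrE ?expR_ge0 ?divr_ge0 // ?ltW //.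
  rewrite -expRM_natl (_ : 2%:R * (2^-1 * L) = L) ?EL; last by field.
  by rewrite expr2; nra.
pose a : R := 2 * i%:R / n%:R.
have a01 : 0 <= a <= 1.
  rewrite /a divr_ge0 ?mulr_ge0 //= ler_pdivrMr // mul1r.
  by rewrite -natrM ler_nat; lia.
have decay : expR (i%:R / n%:R * L) <= 1 + i%:R / 20.
  rewrite (_ : i%:R / n%:R * L = a * (2^-1 * L)); last first.
    by rewrite /a; field; rewrite gt_eqF.
  apply: le_trans (expR_mul_le _ a01) _; rewrite lerD2l.
  apply: (@le_trans _ _ (a * (n%:R / 40))).
    by case/andP: a01 => a0 _; rewrite ler_wpM2l //; lra.
  by rewrite /a le_eqVlt; apply/orP; left; apply/eqP; field; rewrite gt_eqF.
have -> : - (i.+1%:R * (n%:R - i.+1%:R + 1) / n%:R * L) =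
    i.+1%:R * (i%:R / n%:R * L) - i.+1%:R * L.
  by rewrite -natr1; field; rewrite gt_eqF.
rewrite expRD expRN !expRM_natl EL.
have /= mle := @multiplicity_le R n i.+1 isT i2.
have X0 : 0 < (n%:R - 1) ^+ i.+1 :> R by rewrite exprn_gt0.
apply: (@le_trans _ _ ((n%:R - 1) ^+ i.+1 / i.+1`!%:R *
   ((1 + i%:R / 20) ^+ i.+1 / (n%:R - 1) ^+ i.+1))).
  apply: ler_pM => //.
  - exact: (@multiplicity_ge0 R n i.+1).
  - by rewrite divr_ge0 ?exprn_ge0 ?expR_ge0 // ltW.
  rewrite ler_pM2r ?invr_gt0 //; apply: lerXn2r decay; rewrite nnegrE ?expR_ge0 //.
rewrite /majorant le_eqVlt; apply/orP; left; apply/eqP.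
by field; rewrite !gt_eqF // ltr0n fact_gt0.
Qed.

Lemma l2_profile_cutoff_le4 n l (c : R) : (1600 <= n)%N -> (2 * l <= n)%N ->
  0 <= c -> l2_profile n l (cutoff_time n c) <= 4 * expR (- (4 * c)).
Proof.
move=> n1600 l2 c0.
apply: (@le_trans _ _ ((\sum_(j < l) majorant R j) * expR (- (4 * c)))).
  rewrite /l2_profile big_add1 /= big_mkord mulr_suml; apply: ler_sum => i _.
  have i2 : (2 * i.+1 <= n)%N by have := ltn_ord i; lia.
  apply: le_trans (l2_profile_term_le _ i2 c0) _ => //.
  rewrite ler_wpM2r ?expR_ge0 //.
  exact: multiplicity_decay_le_majorant.
by rewrite ler_wpM2r ?expR_ge0 // sum_majorant_le4.
Qed.

(** At c = 0 each term is at most its multiplicity, and these telescope to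
    C(n,l) - 1. *)
Lemma l2_profile_cutoff_le_pow2 n l (c : R) : (0 < l)%N -> (2 * l <= n)%N ->
  0 <= c -> l2_profile n l (cutoff_time n c) <= 2 ^+ n * expR (- (4 * c)).
Proof.
move=> l0 l2 c0.
have n1 : 1 <= n%:R - 1 :> R.
  have : 2 <= n%:R :> R by rewrite ler_nat; lia.
  lra.
apply: (@le_trans _ _ ((\sum_(0 <= j < l) ('C(n, j.+1)%:R - 'C(n, j)%:R)) *
                        expR (- (4 * c)))).
  rewrite /l2_profile big_add1 /= !big_mkord mulr_suml; apply: ler_sum => i _.
  have i2 : (2 * i.+1 <= n)%N by have := ltn_ord i; lia.
  apply: le_trans (l2_profile_term_le _ i2 c0) _ => //.
  apply: ler_wpM2r; first exact: expR_ge0.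
  rewrite ler_piMr ?(@multiplicity_ge0 R n i.+1) //.
  rewrite -[leRHS](expR0 R) ler_expR oppr_le0 mulr_ge0 ?ln_ge0 //.
  by apply: (le_trans ler01); apply: rate_ge1; lia.
apply: ler_wpM2r; first exact: expR_ge0.
rewrite telescope_sumr // bin0 lerBlDr -natrX natr1 ler_nat leqW //.
have -> : (2 ^ n)%N = #|{set 'I_n}|.
  by rewrite -[RHS]cardsT -powersetT card_powerset cardsT card_ord.
rewrite -(card_uep_state n l); exact: (leq_card _ val_inj).
Qed.

Lemma l2_profile_cutoff_bounded : exists2 B : R, 0 < B &
  forall n l (c : R), (0 < l)%N -> (2 * l <= n)%N -> 0 <= c ->
    l2_profile n l (cutoff_time n c) <= B * expR (- (4 * c)).
Proof.
exists (4 + 2 ^+ 1600) => [|n l c l0 l2 c0].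
  by rewrite addr_gt0 // exprn_gt0.
have [n1600|n1600] := leqP 1600 n.
  apply: le_trans (l2_profile_cutoff_le4 n1600 l2 c0) _.
  by rewrite ler_wpM2r ?expR_ge0 // lerDl exprn_ge0.
apply: le_trans (l2_profile_cutoff_le_pow2 l0 l2 c0) _.
rewrite ler_wpM2r ?expR_ge0 // -[leLHS]add0r lerD //.
by apply: ler_weXn2l; [lra | exact: ltnW].
Qed.

End Cutoff.

(** * Mixing time *)

Lemma l2_dist_ge0 (R : realType) (S : finType) (mu pi : S -> R) :
  0 <= l2_dist mu pi.
Proof. exact: sqrtr_ge0. Qed.

Lemma expR_sqr (R : realType) (x : R) : expR x ^+ 2 = expR (2 * x).
Proof. by rewrite -expRM_natl. Qed.

Section Mixing.
Variables (R : realType) (n l : nat) (d : measure_display)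
  (Omega : measurableType d) (P : uep_state n l -> probability Omega R)
  (X : R -> Omega -> uep_state n l).
Hypotheses (l0 : (0 < l)%N) (l2 : (2 * l <= n)%N).
Hypothesis uepX : is_uep (2 / n%:R ^+ 2) P X.

Lemma uep_law_l2_sqr x0 t : 0 <= t ->
  l2_dist (process_law P X x0 t) uniform_dist ^+ 2 = l2_profile n l t.
Proof.
move=> t0; have [p pq Pp] := process_law_semigroup uepX.
have n0 : n%:R != 0 :> R by rewrite pnatr_eq0; lia.
rewrite Pp // (uep_l2_dist_sqr pq) //; last by lia.
by apply: eq_bigr => i _; congr (_ * expR (- _)); field.
Qed.

Lemma uep_l2_max t : 0 <= t ->
  \big[Num.max/0]_(x0 : uep_state n l)
     l2_dist (process_law P X x0 t) uniform_dist = Num.sqrt (l2_profile n l t).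
Proof.
move=> t0.
have law x0 : l2_dist (process_law P X x0 t) uniform_dist =
    Num.sqrt (l2_profile n l t).
  by rewrite -(uep_law_l2_sqr x0 t0) sqrtr_sqr ger0_norm ?l2_dist_ge0.
have /card_gt0P[x0 _] : (0 < #|{: uep_state n l}|)%N.
  by rewrite card_uep_state bin_gt0; lia.
rewrite (eq_bigr _ (fun x _ => law x)); apply/eqP; rewrite eq_le.
apply/andP; split.
  by apply/bigmax_leP; split=> [|x _]; rewrite ?sqrtr_ge0.
by rewrite (bigD1 x0) //= le_max lexx.
Qed.

Lemma uep_mixing_level eps t : 0 < eps -> 0 <= t ->
  (\big[Num.max/0]_(x0 : uep_state n l)
     l2_dist (process_law P X x0 t) uniform_dist <= 2 * eps) =
  (l2_profile n l t <= (2 * eps) ^+ 2).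
Proof.
move=> e0 t0; rewrite uep_l2_max //.
have e2 : 0 <= 2 * eps by lra.
rewrite -[in LHS](ger0_norm e2) -sqrtr_sqr ler_sqrt //.
exact: sqr_ge0.
Qed.

(** Below the lower bound the term of index 1 alone exceeds the level, where
    n - 1 >= n/2 accounts for the ln 2; the upper bound is a time at which the
    level has been reached. *)
Lemma uep_mixing_time_bounds (B eps : R) : 0 < eps -> 0 < B ->
  (forall c, 0 <= c -> l2_profile n l (cutoff_time n c) <= B * expR (- (4 * c))) ->
  exists2 C : R,
    - (`|ln 2 + ln ((2 * eps) ^+ 2)| / 4) <= C <=
      `|ln B - ln ((2 * eps) ^+ 2)| / 4 &
    l2_mixing_time P X uniform_dist eps =
      (4^-1 * n%:R * ln n%:R + C * n%:R)%:E.
Proof.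
move=> e0 B0 profB.
have n2 : 2 <= n%:R :> R by rewrite ler_nat; lia.
have n0 : 0 < n%:R :> R by lra.
set E := (2 * eps) ^+ 2.
have E0 : 0 < E by rewrite exprn_gt0 //; lra.
set c1 := _ / 4; set c2 := `|ln B - _| / 4.
rewrite /l2_mixing_time; set A := (A in ereal_inf A).
have lnn : ln (n%:R - 1) <= ln n%:R :> R by rewrite ler_ln ?posrE; lra.
have lnn1 : 0 <= ln (n%:R - 1) :> R by rewrite ln_ge0 //; lra.
have c20 : 0 <= c2 by rewrite divr_ge0.
have lo : ((4^-1 * n%:R * ln n%:R - c1 * n%:R)%:E <= ereal_inf A)%E.
  apply: le_ereal_inf_tmp => _ [t [t0 tA] <-]; rewrite lee_fin.
  move: tA; rewrite uep_mixing_level // => /(le_trans (l2_profile_ge t l0 l2)) tA.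
  have half : n%:R / 2 * expR (- (4 * t / n%:R)) <= E.
    apply: le_trans tA; rewrite ler_wpM2r ?expR_ge0 //; lra.
  have : ln n%:R - ln 2 - 4 * t / n%:R <= ln E.
    rewrite -ler_expR (lnK E0) !expRD !expRN !lnK ?posrE // -expRN //.
  have c1E : ln 2 + ln E <= 4 * c1.
    by rewrite /c1 mulrCA divff ?mulr1 ?ler_norm // pnatr_eq0.
  move=> h.
  have : ln n%:R - 4 * c1 <= 4 * t / n%:R by lra.
  by rewrite ler_pdivlMr //; lra.
have hi : (ereal_inf A <= (4^-1 * n%:R * ln n%:R + c2 * n%:R)%:E)%E.
  apply: ereal_inf_lbound; eexists; last by [].
  set t := _ + _.
  have t0 : 0 <= t by rewrite addr_ge0 ?mulr_ge0 ?invr_ge0 //; lra.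
  split=> //; rewrite uep_mixing_level //.
  (* the cutoff time is centred at n ln(n-1) / 4, the goal at n ln n / 4 *)
  pose c := c2 + 4^-1 * (ln n%:R - ln (n%:R - 1)).
  have tc : t = cutoff_time n c by rewrite /t /cutoff_time /c; ring.
  have cc2 : c2 <= c by rewrite /c; lra.
  rewrite tc; apply: le_trans (profB c _) _; first lra.
  rewrite -[leRHS](lnK E0) -[X in X * _](lnK B0) -expRD ler_expR.
  have : ln B - ln E <= 4 * c2.
    by rewrite /c2 mulrCA divff ?mulr1 ?ler_norm // pnatr_eq0.
  lra.
move: lo hi; case: (ereal_inf A) => [r| |] //=.
rewrite !lee_fin => lo hi.
exists ((r - 4^-1 * n%:R * ln n%:R) / n%:R).
  by rewrite ler_pdivlMr // ler_pdivrMr //; apply/andP; split; lra.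
by congr (_%:E); field; rewrite gt_eqF.
Qed.

End Mixing.

Theorem theorem1p4 (R : realType) :
  (forall (n l : nat) (d : measure_display) (Omega : measurableType d)
      (P : uep_state n l -> probability Omega R)
      (X : R -> Omega -> uep_state n l),
    (0 < l)%N -> (2 * l <= n)%N -> is_uep (2 / n%:R ^+ 2) P X ->
    forall (x0 : uep_state n l) (t : R), 0 <= t ->
      l2_dist (process_law P X x0 t) uniform_dist ^+ 2 =
      \sum_(1 <= i < l.+1) ('C(n, i)%:R - 'C(n, i.-1)%:R) *
        expR (- (4 * i%:R * (n%:R - i%:R + 1) * t / n%:R ^+ 2)))
  /\
  (forall (n l : nat) (d : measure_display) (Omega : measurableType d)
      (P : uep_state n l -> probability Omega R)
      (X : R -> Omega -> uep_state n l),
    (0 < l)%N -> (2 * l <= n)%N -> is_uep (2 / n%:R ^+ 2) P X ->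
    forall (x0 : uep_state n l) (c t : R),
      t = 4^-1 * n%:R * ln (n%:R - 1) + c * n%:R -> 0 <= t ->
      expR (- (2 * c)) <= l2_dist (process_law P X x0 t) uniform_dist)
  /\
  (exists N : nat, forall (n l : nat) (d : measure_display)
      (Omega : measurableType d) (P : uep_state n l -> probability Omega R)
      (X : R -> Omega -> uep_state n l),
    (N <= n)%N ->
    (0 < l)%N -> (2 * l <= n)%N -> is_uep (2 / n%:R ^+ 2) P X ->
    forall (x0 : uep_state n l) (c t : R),
      t = 4^-1 * n%:R * ln (n%:R - 1) + c * n%:R -> 0 <= c ->
      l2_dist (process_law P X x0 t) uniform_dist <= 2 * expR (- (2 * c)))
  /\
  (forall eps : R, 0 < eps < 1 ->
    exists K : R, forall (n l : nat) (d : measure_display)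
      (Omega : measurableType d) (P : uep_state n l -> probability Omega R)
      (X : R -> Omega -> uep_state n l),
    (0 < l)%N -> (2 * l <= n)%N -> is_uep (2 / n%:R ^+ 2) P X ->
    exists C : R, `|C| <= K /\
      l2_mixing_time P X uniform_dist eps =
      (4^-1 * n%:R * ln n%:R + C * n%:R)%:E).
Proof.
split; [|split; [|split]].
- by move=> n l d Omega P X l0 l2 uepX x0 t t0; rewrite (uep_law_l2_sqr l0 l2 uepX).
- move=> n l d Omega P X l0 l2 uepX x0 c t tE t0.
  have n2 : 2 <= n%:R :> R by rewrite ler_nat; lia.
  have n0 : 0 < n%:R :> R by lra.
  have n1 : 0 < n%:R - 1 :> R by lra.
  rewrite -(@ler_pXn2r _ 2) ?nnegrE ?expR_ge0 ?l2_dist_ge0 //.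
  rewrite (uep_law_l2_sqr l0 l2 uepX) //.
  apply: le_trans (l2_profile_ge t l0 l2).
  rewrite -[X in X * expR _](lnK n1) -expRD expR_sqr tE ler_expR.
  rewrite le_eqVlt; apply/orP; left; apply/eqP; field; lra.
- exists 1600 => n l d Omega P X n1600 l0 l2 uepX x0 c t tE c0.
  have n2 : 2 <= n%:R :> R by rewrite ler_nat; lia.
  have t0 : 0 <= t.
    rewrite tE addr_ge0 ?mulr_ge0 ?invr_ge0 ?ln_ge0 //; lra.
  rewrite -(@ler_pXn2r _ 2) ?nnegrE ?mulr_ge0 ?expR_ge0 ?l2_dist_ge0 //.
  rewrite (uep_law_l2_sqr l0 l2 uepX) // tE exprMn expR_sqr.
  apply: le_trans (l2_profile_cutoff_le4 n1600 l2 c0) _.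
  rewrite (_ : 2 * - (2 * c) = - (4 * c)); last by ring.
  by rewrite (_ : 2 ^+ 2 = 4) // expr2; ring.
- move=> eps /andP[e0 _]; have [B B0 profB] := l2_profile_cutoff_bounded R.
  set c1 := `|ln 2 + ln ((2 * eps) ^+ 2)| / 4.
  set c2 := `|ln B - ln ((2 * eps) ^+ 2)| / 4.
  exists (c1 + c2) => n l d Omega P X l0 l2 uepX.
  have [C /andP[Clo Chi] tauE] :=
    uep_mixing_time_bounds l0 l2 uepX e0 B0 (fun c => @profB n l c l0 l2).
  exists C; split=> //; rewrite ler_norml; apply/andP; split.
    by apply: le_trans Clo; rewrite lerN2 lerDl divr_ge0.
  by apply: le_trans Chi _; rewrite lerDr divr_ge0.
Qed.
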